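(* Let $n\ge 2$, let $\mathbf{F} \in L^1(\mathbb{R}^n;\mathbb{R}^n)$ with precise majorant $h$, and let $E \subset \mathbb{R}^n$ be a set of finite perimeter such that the topological boundary $\partial E$ satisfies the uniform lower density condition. Then there exists a constant $\gamma = \gamma(n,E)>0$, depending only on $n$ and $E$ (the mollifier used to define precise majorants being fixed), such that $$\liminf_{\varepsilon\downarrow 0} \frac{1}{2\varepsilon} \int_{B_{\varepsilon}(\partial E)} |\mathbf{F}| \,\mathrm{d}x \leq \gamma\int_{\partial E} h \,\mathrm{d}\mathcal{H}^{n-1}.$$
   Context: Notation: $\mathcal{H}^{n-1}$ is the $(n-1)$-dimensional Hausdorff measure; $B_r(x)$ is the ball of radius $r$ centred at $x$, $B_r=B_r(0)$; for $A\subset\mathbb{R}^n$, $B_\varepsilon(A) = A+B_\varepsilon$ is the $\varepsilon$-neighbourhood of $A$. Precise majorant. Fix once and for all a standard radial mollifier $\rho\in C_c^\infty(B_1)$ on $\mathbb{R}^n$ (non-negative, radial, $\int\rho=1$, $\rho(0)>0$) and put $\rho_\delta(x)=\delta^{-n}\rho(x/\delta)$. Let $\Omega\subset\mathbb{R}^n$ be open (here $\Omega=\mathbb{R}^n$). For a non-negative scalar function $F\in L^1(\Omega)$, extended by zero to $\mathbb{R}^n$, choose a sequence $\delta_k\downarrow0$ such that $F_k:=F*\rho_{\delta_k}$ satisfies $\|F_{k+1}-F_k\|_{L^1(\Omega)}\le 2^{-k}$ for all $k\in\mathbb{N}$. Set $F^*(x)=\lim_{k\to\infty}F_k(x)$ if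 the limit exists and $F^*(x)=0$ otherwise, and define $$h(x):=|F_1(x)|+\sum_{k=1}^\infty|F_{k+1}(x)-F_k(x)|+|F^*(x)|,$$ with $h(x)=\infty$ if the series diverges. Any such $h$ is called a precise majorant of $F$. For a vector field $\mathbf{F}=(F_1,\dots,F_n)\in L^1(\Omega;\mathbb{R}^n)$ (subscripts now denoting components) write $F_i=F_i^+-F_i^-$ with positive and negative parts, let $h_i^\pm$ be precise majorants of $F_i^\pm$ chosen along a common sequence $\delta_k\downarrow0$, and call $h:=\sum_{i=1}^n(h_i^++h_i^-)$ a precise majorant of $\mathbf{F}$. Uniform lower density condition. Let $S\subset\mathbb{R}^n$ be a Borel set with locally finite $\mathcal{H}^{n-1}$-measure, i.e. $\mathcal{H}^{n-1}(S\cap K)<\infty$ for every compact $K\subset\mathbb{R}^n$. $S$ satisfies the uniform lower density condition if there exist $\gamma_0>0$ and $R_0>0$ such that $\mathcal{H}^{n-1}(S\cap B_r(x_0))\ge\gamma_0r^{n-1}$ for all $x_0\in S$ and $r\in(0,R_0)$. (Saying that a set satisfies this condition includes that it is Borel with locally finite $\mathcal{H}^{n-1}$-measure.) *)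

(* Defs.v *)
From HB Require Import structures.
From mathcomp Require Import all_boot all_order all_algebra.
From mathcomp Require Import all_classical all_reals all_analysis.

Set Implicit Arguments.
Unset Strict Implicit.
Unset Printing Implicit Defensive.
Import Order.TTheory GRing.Theory Num.Theory.
Import numFieldTopology.Exports numFieldNormedType.Exports.

Local Open Scope classical_set_scope.
Local Open Scope ring_scope.

Section euclidean.
Context {R : realType} {n : nat}.
Implicit Types (x : 'rV[R]_n) (A : set 'rV[R]_n).

(* The library's norm `|x| on 'rV[R]_n is the sup norm.  It induces the usual
   topology, which is the only thing taken from it below. *)
Definition enorm x : R := Num.sqrt (\sum_(i < n) x 0 i ^+ 2).

Definition eball x (r : R) : set 'rV[R]_n := [set y | enorm (y - x) < r].

Definition enbhd A (e : R) : set 'rV[R]_n :=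
  [set x | exists2 a, A a & enorm (x - a) < e].

Definition frontier A : set 'rV[R]_n := closure A `\` interior A.

(* Adding 0 to the set of distances makes the diameter of set0 equal to 0. *)
Definition ediam A : \bar R :=
  ereal_sup ([set 0%E] `|` [set (enorm (x - y))%:E | x in A & y in A]).

Lemma ediam_ge0 A : (0 <= ediam A)%E.
Proof. by apply: ereal_sup_ubound; left. Qed.

End euclidean.

(* The outer measure generated by covers: the infimum of the total weight of
   the countable covers of A by sets U i with i in adm.  Finite covers are
   encoded by the indices k with C k = None. *)
Section cover_outer.
Local Open Scope ereal_scope.
Context {R : realType} {T I : Type}.
Variables (adm : set I) (U : I -> set T) (w : I -> \bar R).

Definition cover_of (A : set T) : set (nat -> option I) :=
  [set C | (forall k i, C k = Some i -> adm i) /\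
           A `<=` \bigcup_k oapp U set0 (C k)].

Definition cover_outer (A : set T) : \bar R :=
  ereal_inf [set \sum_(k <oo) oapp w 0 (C k) | C in cover_of A].

Hypothesis w_ge0 : forall i, 0 <= w i.

Let ow_ge0 (o : option I) : 0 <= oapp w 0 o.
Proof. by case: o. Qed.

Lemma cover_outer_ge0 A : 0 <= cover_outer A.
Proof.
by apply: le_ereal_inf_tmp => _ [C _ <-]; apply: nneseries_ge0 => k _ _.
Qed.

Lemma cover_outer0 : cover_outer set0 = 0.
Proof.
apply/eqP; rewrite eq_le cover_outer_ge0 andbT.
apply: ereal_inf_lbound; exists (fun=> None); first by split.
exact: eseries0.
Qed.

Lemma le_cover_outer : {homo cover_outer : A B / A `<=` B >-> A <= B}.
Proof.
move=> A B AB; apply/ereal_inf_le_tmp => x [C [mC BC] <-{x}].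
by exists C => //; split => //; apply: subset_trans AB BC.
Qed.

Lemma cover_outer_sigma_subadditive : sigma_subadditive cover_outer.
Proof.
move=> A; have [[i ioo]|] := pselect (exists i, cover_outer (A i) = +oo).
  rewrite (eseries_pinfty _ _ ioo) ?leey// => n _.
  by rewrite -ltNye (lt_le_trans _ (cover_outer_ge0 _)).
rewrite -forallNE => Aoo.
suff add2e (e : {posnum R}) : cover_outer (\bigcup_n A n) <=
    \sum_(i <oo) cover_outer (A i) + e%:num%:E.
  by apply/lee_addgt0Pr => _/posnumP[].
rewrite (le_trans _ (epsilon_trick _ _ _))//; last first.
  by move=> n; exact: cover_outer_ge0.
pose P n (B : nat -> option I) := cover_of (A n) B /\
  \sum_(k <oo) oapp w 0 (B k) <=
    cover_outer (A n) + (e%:num / (2 ^ n.+1)%:R)%:E.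
have [G PG] : {G : nat -> nat -> option I & forall n, P n (G n)}.
  apply: (@choice _ _ P) => n; rewrite /P /cover_outer.
  set S := (X in ereal_inf X); move infS : (ereal_inf S) => iS.
  case: iS infS => [r Sr|Soo|Soo].
  - have en1 : (0 < e%:num / (2 ^ n.+1)%:R)%R by [].
    have /(lb_ereal_inf_adherent en1) : ereal_inf S \is a fin_num by rewrite Sr.
    move=> [x [B [mB AnB] muBx xS]].
    by exists B; split => //; rewrite muBx -Sr; exact/ltW.
  - by have := Aoo n; rewrite /cover_outer Soo.
  - suff : lbound S 0 by move/le_ereal_inf_tmp; rewrite Soo.
    by move=> /= _ [B [mB AnB] <-]; exact: nneseries_ge0.
pose wG := (oapp w 0) \o uncurry G.
have wG_ge0 x : 0 <= wG x by exact: ow_ge0.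
apply: (@le_trans _ _ (\esum_(i in setT) wG i)).
  rewrite /cover_outer; apply: ereal_inf_lbound => /=.
  have /card_esym/ppcard_eqP[f] := card_nat2.
  exists (uncurry G \o f).
    split => [k i|t [i _]].
      by rewrite /= /uncurry; case: (f k) => a b; apply: (PG a).1.1.
    move=> /((PG i).1.2) -[j _ Gijt]; exists (f^-1%FUN (i, j)) => //=.
    by rewrite invK ?inE.
  rewrite -(esum_pred_image wG _ xpredT) ?[fun=> _]set_true//.
  by rewrite image_eq.
rewrite (_ : esum _ _ = \sum_(i <oo) \sum_(j <oo) oapp w 0 (G i j)); last first.
  pose J : nat -> set (nat * nat) := fun i => [set (i, j) | j in setT].
  rewrite (_ : setT = \bigcup_k J k); last first.
    by rewrite predeqE => -[a b]; split => // _; exists a => //; exists b.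
  rewrite esum_bigcupT /=; last 2 first.
    - apply/trivIsetP => i j _ _ ij.
      rewrite predeqE => -[k m] /=; split => //= -[] [_] _ [<-{k} _].
      by move=> [m' _] [] /esym/eqP; rewrite (negbTE ij).
    - by [].
  rewrite -(image_id [set: nat]) -fun_true esum_pred_image//; last first.
    by move=> k _; exact: esum_ge0.
  apply: eq_eseriesr => /= j _.
  rewrite -(esum_pred_image wG (pair j) predT)//=; last first.
    by move=> ? ? _ _; exact: (@can_inj _ _ _ snd).
  by congr esum; rewrite predeqE => -[a b]; split; move=> [i _ <-]; exists i.
apply: lee_nneseries => [i _ _|i _]; last exact: (PG i).2.
exact: nneseries_ge0.
Qed.

End cover_outer.

Section lebesgue.
Context (R : realType) (n : nat).

Definition half_open_box (ab : 'rV[R]_n * 'rV[R]_n) : set 'rV[R]_n :=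
  [set x | forall i, ab.1 0 i < x 0 i <= ab.2 0 i].

Definition box_volume (ab : 'rV[R]_n * 'rV[R]_n) : \bar R :=
  (\prod_(i < n) Num.max 0 (ab.2 0 i - ab.1 0 i))%:E.

Definition leb_outer : set 'rV[R]_n -> \bar R :=
  cover_outer setT half_open_box box_volume.

Let box_volume_ge0 ab : (0 <= box_volume ab)%E.
Proof. by rewrite lee_fin prodr_ge0// => i _; rewrite le_max lexx. Qed.

HB.instance Definition _ := isOuterMeasure.Build R 'rV[R]_n leb_outer
  (cover_outer0 _ _ box_volume_ge0) (cover_outer_ge0 _ _ box_volume_ge0)
  (@le_cover_outer _ _ _ _ _ _)
  (cover_outer_sigma_subadditive _ _ box_volume_ge0).

(* Lebesgue measure, on the sigma-algebra of all Lebesgue-measurable sets. *)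
Definition leb : set (caratheodory_type leb_outer) -> \bar R := leb_outer.

HB.instance Definition _ := isMeasure.Build _ _ _ leb
  (@caratheodory_measure0 R _ leb_outer)
  (@caratheodory_measure_ge0 R _ leb_outer)
  (@caratheodory_measure_sigma_additive R _ leb_outer).

End lebesgue.
Arguments leb {R n}.

Section hausdorff.
Local Open Scope ereal_scope.
Context (R : realType) (n k : nat).

(* omega_k 2^-k diam(A)^k, omega_k being the volume of the unit ball of R^k. *)
Definition hausdorff_weight (A : set 'rV[R]_n) : \bar R :=
  leb (eball (0 : 'rV[R]_k) 1) * ((2^-1)%:E * ediam A) ^+ k.

Definition hausdorff_pre (d : R) : set 'rV[R]_n -> \bar R :=
  cover_outer [set B | ediam B <= d%:E] id hausdorff_weight.

Definition hausdorff_outer (A : set 'rV[R]_n) : \bar R :=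
  ereal_sup [set hausdorff_pre d A | d in [set d : R | (0 < d)%R]].

Let weight_ge0 A : 0 <= hausdorff_weight A.
Proof.
apply: mule_ge0; first exact: measure_ge0.
by apply/expe_ge0/mule_ge0; [rewrite lee_fin invr_ge0 | exact: ediam_ge0].
Qed.

Let hausdorff_outer0 : hausdorff_outer set0 = 0.
Proof.
rewrite /hausdorff_outer; apply/eqP; rewrite eq_le; apply/andP; split.
  by apply: ge_ereal_sup => _ [d _ <-]; rewrite /hausdorff_pre cover_outer0.
apply: ereal_sup_ubound; exists 1%R; first exact: ltr01.
by rewrite /hausdorff_pre cover_outer0.
Qed.

Let hausdorff_outer_ge0 A : 0 <= hausdorff_outer A.
Proof.
apply: (@le_trans _ _ (hausdorff_pre 1 A)); first exact: cover_outer_ge0.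
by apply: ereal_sup_ubound; exists 1%R => //; exact: ltr01.
Qed.

Let le_hausdorff_outer : {homo hausdorff_outer : A B / A `<=` B >-> A <= B}.
Proof.
move=> A B AB; apply: ge_ereal_sup => _ [d d0 <-].
apply: (@le_trans _ _ (hausdorff_pre d B)); first exact: le_cover_outer.
by apply: ereal_sup_ubound; exists d.
Qed.

Let hausdorff_outer_subadd : sigma_subadditive hausdorff_outer.
Proof.
move=> F; apply: ge_ereal_sup => _ [d d0 <-].
apply: (le_trans (cover_outer_sigma_subadditive _ _ weight_ge0 F)).
apply: lee_nneseries => [i _ _|i _]; first exact: cover_outer_ge0.
by apply: ereal_sup_ubound; exists d.
Qed.

HB.instance Definition _ := isOuterMeasure.Build R 'rV[R]_n hausdorff_outer
  hausdorff_outer0 hausdorff_outer_ge0 le_hausdorff_outer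
  hausdorff_outer_subadd.

Definition hausdorff : set (caratheodory_type hausdorff_outer) -> \bar R :=
  hausdorff_outer.

HB.instance Definition _ := isMeasure.Build _ _ _ hausdorff
  (@caratheodory_measure0 R _ hausdorff_outer)
  (@caratheodory_measure_ge0 R _ hausdorff_outer)
  (@caratheodory_measure_sigma_additive R _ hausdorff_outer).

End hausdorff.
Arguments hausdorff {R n} k.

Section functions_and_sets.
Context {R : realType} {n : nat}.
Notation Rn := 'rV[R]_n.

Definition basis_vec (i : 'I_n) : Rn := delta_mx 0 i.

Fixpoint Ck (k : nat) (f : Rn -> R) : Prop :=
  if k is k'.+1 then
    continuous f /\ forall i : 'I_n,
      (forall x, derivable f x (basis_vec i)) /\ Ck k' ('D_(basis_vec i) f)
  else continuous f.

Definition smooth (f : Rn -> R) := forall k, Ck k f.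

Definition supp (f : Rn -> R) : set Rn := closure [set x | f x != 0].

Record standard_mollifier (rho : Rn -> R) : Prop := StandardMollifier {
  mollifier_smooth : smooth rho ;
  mollifier_compact : compact (supp rho) ;
  mollifier_supp : supp rho `<=` eball 0 1 ;
  mollifier_ge0 : forall x, 0 <= rho x ;
  mollifier_radial : forall x y, enorm x = enorm y -> rho x = rho y ;
  mollifier_int : (\int[leb]_x (rho x)%:E = 1)%E ;
  mollifier_gt0 : 0 < rho 0 }.

Definition rescale (rho : Rn -> R) (d : R) : Rn -> R :=
  fun x => d ^- n * rho (d^-1 *: x).

Definition convolution (f g : Rn -> R) : Rn -> R :=
  fun x => \int[leb]_y (f y * g (x - y)).

Definition mollify (rho : Rn -> R) (delta : nat -> R) (f : Rn -> R) (k : nat)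
  : Rn -> R := convolution f (rescale rho (delta k)).

(* The functions F_k are indexed by k >= 1; delta 0 plays no role. *)
Definition decreasing_to0 (delta : nat -> R) :=
  [/\ forall k, (1 <= k)%N -> 0 < delta k,
      forall k, (1 <= k)%N -> delta k.+1 <= delta k
    & delta @ \oo --> (0 : R)].

Definition fast_L1 (rho : Rn -> R) (delta : nat -> R) (f : Rn -> R) :=
  forall k, (1 <= k)%N ->
    (\int[leb]_x `|mollify rho delta f k.+1 x - mollify rho delta f k x|%:E
       <= (2 ^- k)%:E)%E.

Definition precise_repr (rho : Rn -> R) (delta : nat -> R) (f : Rn -> R)
  (x : Rn) : R :=
  let u := fun k => mollify rho delta f k x in
  if `[< cvgn u >] then limn u else 0.

Definition majorant_formula (rho : Rn -> R) (delta : nat -> R) (f : Rn -> R)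
  (x : Rn) : \bar R :=
  (`|mollify rho delta f 1 x|%:E
   + \sum_(1 <= k <oo)
       `|mollify rho delta f k.+1 x - mollify rho delta f k x|%:E
   + `|precise_repr rho delta f x|%:E)%E.

Definition precise_majorant_along (rho : Rn -> R) (delta : nat -> R)
    (f : Rn -> R) (h : Rn -> \bar R) :=
  [/\ decreasing_to0 delta, fast_L1 rho delta f
    & forall x, h x = majorant_formula rho delta f x].

Definition component (F : Rn -> Rn) (i : 'I_n) : Rn -> R := fun x => F x 0 i.

Definition L1_field (F : Rn -> Rn) :=
  forall i, leb.-integrable setT (EFin \o component F i).

Definition precise_majorant (rho : Rn -> R) (F : Rn -> Rn)
    (h : Rn -> \bar R) :=
  exists (delta : nat -> R) (hp hm : 'I_n -> Rn -> \bar R),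
    [/\ forall i, precise_majorant_along rho delta (component F i)^\+ (hp i),
        forall i, precise_majorant_along rho delta (component F i)^\- (hm i)
      & forall x, h x = (\sum_(i < n) (hp i x + hm i x))%E].

Definition divergence (phi : Rn -> Rn) (x : Rn) : R :=
  \sum_(i < n) 'D_(basis_vec i) (component phi i) x.

Definition perimeter (E : set Rn) : \bar R :=
  ereal_sup [set (\int[leb]_(x in E) (divergence phi x)%:E)%E | phi in
    [set phi : Rn -> Rn |
      [/\ forall i, Ck 1 (component phi i),
          compact (closure [set x | phi x != 0])
        & forall x, enorm (phi x) <= 1]]].

Definition finite_perimeter (E : set Rn) :=
  measurable (E : set (caratheodory_type (@leb_outer R n))) /\
  (perimeter E < +oo)%E.

Definition borel_set (S : set Rn) := <<s @open Rn >> S.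

Definition uniform_lower_density (S : set Rn) :=
  [/\ borel_set S,
      forall K : set Rn, compact K -> (hausdorff n.-1 (S `&` K) < +oo)%E
    & exists gamma0 R0 : R, [/\ 0 < gamma0, 0 < R0 &
        forall x0 r, S x0 -> 0 < r < R0 ->
          ((gamma0 * r ^+ n.-1)%:E <= hausdorff n.-1 (S `&` eball x0 r))%E]].

End functions_and_sets.

(* Main.v *)
From HB Require Import structures.
Require Import Defs.
From mathcomp Require Import all_boot all_order all_algebra.
From mathcomp Require Import all_classical all_reals all_analysis.
From mathcomp Require Import measurable_realfun.
From mathcomp Require Import ring lra.
Set Implicit Arguments.
Unset Strict Implicit.
Unset Printing Implicit Defensive.
Import Order.TTheory GRing.Theory Num.Theory.
Import numFieldTopology.Exports numFieldNormedType.Exports.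
Local Open Scope classical_set_scope.
Local Open Scope ring_scope.

(** Fix c, s > 0 with rho >= c on the ball of radius s around the origin, and
    let S be the frontier of E, with density constant g.  For a non-negative
    integrable f and a mollification scale delta, the kernel is at least
    c delta^-n on the ball of radius s delta, so that
      c delta^-n \int_(B(x, s delta)) f <= (f * rho_delta) x
    (mollify_ge).  Integrate over x in S against the Hausdorff measure H and
    exchange the integrals: the left-hand side becomes
      c delta^-n \int f(y) H (S `&` B(y, s delta)) dy.
    With eps = s delta / 2, every y in the eps-neighbourhood of S has a ball
    B(x, eps) with x in S inside B(y, s delta), and the lower density
    condition bounds H (S `&` B(y, s delta)) from below by g eps^(n-1).  Hence
      1 / (2 eps) \int_(eps-neighbourhood of S) f <=
        (2 c g)^-1 (2 / s)^n \int_S (f * rho_delta) dH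
    (integral_enbhd_le).  Along the sequence delta_k that defines the majorant,
    f * rho_(delta_k) is bounded by the majorant of f, since it is the first
    mollification plus a telescoping sum of increments
    (mollify_le_majorant).  Because all the positive and negative parts of the
    components of F share that sequence, this applies to the sum f of all the
    parts, which dominates |F|, at the scales eps_k = s delta_k / 2.  These
    tend to 0, hence end up below the radius up to which the density condition
    holds, and the lower limit satisfies the same bound.

    The exchange of integrals rests on measurability with respect to the two
    Caratheodory sigma-algebras.  Half-spaces are measurable for both: for
    Lebesgue measure because hyperplanes cut boxes additively, for Hausdorff
    measure by Caratheodory's criterion (metric_outer_caratheodory), which also
    shows that S itself is measurable.  Coordinates are then measurable, and so
    is the set of pairs of points at distance less than a given r.  The
    restriction of H to S is sigma-finite because it is finite on compact
    cubes. *)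

(** * The Euclidean norm *)

Section euclidean_norm.
Context {R : realType} {n : nat}.
Implicit Types x y z : 'rV[R]_n.

Lemma sumsq_ge0 x : 0 <= \sum_(i < n) x 0 i ^+ 2.
Proof. by apply: sumr_ge0 => i _; exact: sqr_ge0. Qed.

Lemma enorm_ge0 x : 0 <= enorm x.
Proof. exact: sqrtr_ge0. Qed.

Lemma sqr_enorm x : enorm x ^+ 2 = \sum_(i < n) x 0 i ^+ 2.
Proof. by rewrite sqr_sqrtr// sumsq_ge0. Qed.

Lemma enorm_opp x : enorm (- x) = enorm x.
Proof. by congr Num.sqrt; apply: eq_bigr => i _; rewrite mxE sqrrN. Qed.

Lemma enorm_distC x y : enorm (x - y) = enorm (y - x).
Proof. by rewrite -enorm_opp opprB. Qed.

Lemma enormZ (a : R) x : enorm (a *: x) = `|a| * enorm x.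
Proof.
rewrite /enorm -sqrtr_sqr -sqrtrM ?sqr_ge0// mulr_sumr.
by congr Num.sqrt; apply: eq_bigr => i _; rewrite mxE exprMn.
Qed.

Lemma coord_le_enorm x i : `|x 0 i| <= enorm x.
Proof.
rewrite -sqrtr_sqr ler_wsqrtr// (bigD1 i)//= lerDl.
by apply: sumr_ge0 => j _; exact: sqr_ge0.
Qed.

Lemma norm_le_enorm x : `|x| <= enorm x.
Proof.
rewrite [leLHS]mx_normrE; apply: bigmax_le => [|[i j] _].
  exact: enorm_ge0.
by rewrite ord1 coord_le_enorm.
Qed.

Lemma enorm_le_sum x : enorm x <= \sum_(i < n) `|x 0 i|.
Proof.
have s0 : 0 <= \sum_(i < n) `|x 0 i| by exact: sumr_ge0.
rewrite -(ler_pXn2r (n := 2))// ?nnegrE ?enorm_ge0// sqr_enorm expr2.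
rewrite mulr_suml; apply: ler_sum => i _.
rewrite -normr_id -real_normK ?num_real//.
rewrite expr2 !normr_id ler_wpM2l// (bigD1 i)//= lerDl.
exact: sumr_ge0.
Qed.

(** When neither norm vanishes, multiply by 2 |x| |y|: each term then obeys
    2 |x| |y| x_i y_i <= |y|^2 x_i^2 + |x|^2 y_i^2, and these bounds add up
    to 2 |x|^2 |y|^2. *)
Lemma cauchy_schwarz x y : \sum_(i < n) x 0 i * y 0 i <= enorm x * enorm y.
Proof.
have [x0|x0] := eqVneq (enorm x) 0.
  rewrite x0 mul0r big1// => i _.
  have := coord_le_enorm x i; rewrite x0 normr_le0 => /eqP ->.
  by rewrite mul0r.
have [y0|y0] := eqVneq (enorm y) 0.
  rewrite y0 mulr0 big1// => i _.
  have := coord_le_enorm y i; rewrite y0 normr_le0 => /eqP ->.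
  by rewrite mulr0.
have xy0 : 0 < 2 * (enorm x * enorm y).
  by rewrite mulr_gt0// mulr_gt0// lt_neqAle eq_sym ?x0 ?y0 enorm_ge0.
rewrite -(ler_pM2l xy0) mulr_sumr.
have -> : 2 * (enorm x * enorm y) * (enorm x * enorm y) =
   \sum_(i < n) (enorm y ^+ 2 * x 0 i ^+ 2 + enorm x ^+ 2 * y 0 i ^+ 2).
  by rewrite big_split/= -!mulr_sumr -!sqr_enorm; ring.
apply: ler_sum => i _; rewrite -subr_ge0.
have -> : enorm y ^+ 2 * x 0 i ^+ 2 + enorm x ^+ 2 * y 0 i ^+ 2 -
    2 * (enorm x * enorm y) * (x 0 i * y 0 i) =
    (enorm y * x 0 i - enorm x * y 0 i) ^+ 2 by ring.
exact: sqr_ge0.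
Qed.

Lemma enormD x y : enorm (x + y) <= enorm x + enorm y.
Proof.
rewrite -(ler_pXn2r (n := 2))// ?nnegrE ?addr_ge0 ?enorm_ge0//.
have -> : enorm (x + y) ^+ 2 =
    enorm x ^+ 2 + enorm y ^+ 2 + 2 * \sum_(i < n) x 0 i * y 0 i.
  rewrite !sqr_enorm mulr_sumr -!big_split/=; apply: eq_bigr => i _.
  by rewrite mxE; ring.
rewrite sqrrD [leRHS]addrAC lerD2l -[leRHS]mulr_natl ler_wpM2l//.
exact: cauchy_schwarz.
Qed.

Lemma enorm_triangle x y z : enorm (x - z) <= enorm (x - y) + enorm (y - z).
Proof.
by apply: le_trans (enormD _ _); rewrite addrA subrK.
Qed.

Lemma nbhs_eball x (A : set 'rV[R]_n) : nbhs x A ->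
  exists2 e, 0 < e & forall y, enorm (y - x) < e -> A y.
Proof.
move=> /nbhs_ballP[e e0 xA]; exists e => // y yx; apply: xA.
rewrite -ball_normE/=; apply: le_lt_trans (norm_le_enorm _) _.
by rewrite enorm_distC.
Qed.

(** Closedness expressed through Euclidean distances, the form in which
    Caratheodory's criterion uses it. *)
Definition enorm_closed (C : set 'rV[R]_n) := forall x, ~ C x ->
  exists2 e, 0 < e & forall y, C y -> e <= enorm (x - y).

Lemma closed_enorm_closed (C : set 'rV[R]_n) : closed C -> enorm_closed C.
Proof.
move=> /closed_openC oC x Cx.
have /nbhs_eball[e e0 xC] : nbhs x (~` C) by exact: open_nbhs_nbhs.
exists e => // y Cy; rewrite leNgt; apply/negP; rewrite enorm_distC.
by move=> /xC.
Qed.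

Lemma halfspace_enorm_closed i (c : R) :
  enorm_closed [set x : 'rV[R]_n | x 0 i <= c].
Proof.
move=> x /= /negP; rewrite -ltNge => cx; exists (x 0 i - c).
  by rewrite subr_gt0.
move=> y yc; apply: le_trans (coord_le_enorm _ i); rewrite !mxE.
by apply: le_trans (ler_norm _); rewrite lerD2l lerN2.
Qed.

Lemma frontier_closed (A : set 'rV[R]_n) : closed (frontier A).
Proof.
rewrite /frontier setDE; apply: closedI; first exact: closed_closure.
by apply: open_closedC; exact: open_interior.
Qed.

End euclidean_norm.

(** * Caratheodory's criterion for metric outer measures *)

Section metric_outer_measure.
Local Open Scope ereal_scope.
Context {R : realType} {n : nat}.

Definition metric_outer (mu : set 'rV[R]_n -> \bar R) :=
  forall (A B : set 'rV[R]_n) (e : R), (0 < e)%R ->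
    (forall a b, A a -> B b -> (e <= enorm (a - b))%R) ->
    mu A + mu B <= mu (A `|` B).

(** Let A have finite measure and let T k be the points of A at distance at
    least 1 / (k + 1) from C.  Each T k is at positive distance from C, so
    mu (A `&` C) + mu (T k) <= mu A, and it is enough to let k tend to infinity.
    The layers B k between T k.+1 and T k.+2 fill the part of A outside C that
    T k.+1 misses.  As B k is at positive distance from T k, the measures of
    the layers add up: their partial sums stay below
    mu (T N) + mu (T N.+1) <= 2 mu A, hence the tails of their series vanish. *)
Lemma metric_outer_caratheodory (mu : {outer_measure set 'rV[R]_n -> \bar R})
    (C : set 'rV[R]_n) :
  metric_outer mu -> enorm_closed C -> mu.-caratheodory C.
Proof.
move=> mum Ccl; apply: le_caratheodory_measurable => A.
have [->|Afin] := eqVneq (mu A) +oo; first exact: leey.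
have {}Afin : mu A \is a fin_num.
  by rewrite ge0_fin_numE ?outer_measure_ge0// ltey.
pose T k := [set x | A x /\ forall a, C a -> (k.+1%:R^-1 <= enorm (x - a))%R].
have TA k : T k `<=` A by move=> x [].
have Tmono k : T k `<=` T k.+1.
  move=> x [Ax Tx]; split => // a /Tx; apply: le_trans.
  by rewrite lef_pV2 ?posrE// ler_nat.
pose B k := T k.+2 `\` T k.+1.
have mu_le k : mu (T k) <= mu A by apply: le_outer_measure; exact: TA.
have step k : mu (T k) + mu (B k) <= mu (T k.+2).
  apply: (@le_trans _ _ (mu (T k `|` B k))); last first.
    by apply: le_outer_measure => x [/Tmono/Tmono|[]].
  apply: (mum _ _ (k.+1%:R^-1 - k.+2%:R^-1)%R).
    by rewrite subr_gt0 ltf_pV2 ?posrE// ltr_nat.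
  move=> x y [Ax Tx] [[Ay _] /not_andP[//|/existsNP[a]]].
  move=> /not_implyP[Ca /negP]; rewrite -ltNge => ya.
  rewrite lerBlDr; apply: le_trans (Tx _ Ca) _.
  by apply: le_trans (enorm_triangle x y a) _; rewrite lerD2l ltW.
(* Two consecutive bounds alternate: the layer B N is added to T N only, which
   turns the pair (T N, T N.+1) into (T N.+1, T N.+2). *)
have sumB N : \sum_(0 <= k < N) mu (B k) <= mu (T N) + mu (T N.+1).
  elim: N => [|N IH]; first by rewrite big_nil adde_ge0 ?outer_measure_ge0.
  rewrite big_nat_recr//= addeC.
  apply: (le_trans (leeD2l _ IH)); rewrite addeA [mu (B N) + _]addeC addeC.
  by apply: leeD2l; exact: step.
have sumB_fin : \sum_(k <oo) mu (B k) < +oo.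
  apply: (@le_lt_trans _ _ (mu A + mu A)); last first.
    by rewrite -ge0_fin_numE ?adde_ge0 ?outer_measure_ge0// fin_numD Afin.
  apply: lime_le.
    by apply: is_cvg_nneseries => *; exact: outer_measure_ge0.
  apply: nearW => N; apply: (le_trans (sumB N)); exact: leeD.
have tail0 : \sum_(N <= k <oo) mu (B k) @[N --> \oo] --> 0.
  by apply: nneseries_tail_cvg => // k _; exact: outer_measure_ge0.
have bound N : mu (A `&` C) + mu (A `&` ~` C) <=
    mu A + \sum_(N <= k <oo) mu (B k).
  apply: (@le_trans _ _ (mu (A `&` C) + (mu (T N.+1) +
      \sum_(N <= k <oo) mu (B k)))).
    apply: leeD2l; apply: (@le_trans _ _
      (mu (T N.+1 `|` \bigcup_(k in ~` `I_N) B k))).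
      apply: le_outer_measure => x [Ax /Ccl[e e0 Cx]].
      have [k ke] : exists k, T k x.
        exists (Num.truncn e^-1); split => // a /Cx; apply: le_trans.
        rewrite invf_ple ?posrE//; apply/ltW; exact: truncnS_gt.
      have {}ke : T (N.+1 + k)%N x.
        rewrite addnC; elim: (N.+1) => [|m IH]; first by rewrite addn0.
        by rewrite addnS; exact: Tmono.
      elim: k ke => [|k IH]; first by rewrite addn0; left.
      rewrite addnS => Tk; have [/IH//|nT] := pselect (T (N.+1 + k)%N x).
      right; exists (N + k)%N; last by split; rewrite -addSn.
      by rewrite /=; apply/negP; rewrite -leqNgt leq_addr.
    apply: le_trans (outer_measureU2 _ _ _) _; apply: leeD2l.
    exact: outer_measure_sigma_subadditive_tail.
  rewrite addeA; apply: leeD2r.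
  apply: (@le_trans _ _ (mu ((A `&` C) `|` T N.+1))); last first.
    by apply: le_outer_measure => x [[]|/TA].
  apply: (mum _ _ (N.+2%:R^-1)%R); first by rewrite invr_gt0.
  by move=> x y [_ Cx] [_ Ty]; rewrite enorm_distC; exact: Ty.
have lim0 : mu A + \sum_(N <= k <oo) mu (B k) @[N --> \oo] --> mu A + 0.
  apply: cvgeD => //; first by rewrite fin_num_adde_defr.
  exact: cvg_cst.
rewrite -[leRHS]adde0 -(cvg_lim _ lim0)//.
apply: lime_ge; first by apply/cvg_ex; eexists; exact: lim0.
exact: nearW.
Qed.

(** A cover of A `|` B in which no set meets both A and B splits into a cover
    of A and a cover of B. *)
Lemma cover_outerU_separated {I : Type} (adm : set I) (U : I -> set 'rV[R]_n)
    (w : I -> \bar R) (A B : set 'rV[R]_n) :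
  (forall i, 0 <= w i) ->
  (forall i, adm i -> U i `&` A !=set0 -> U i `&` B !=set0 -> False) ->
  cover_outer adm U w A + cover_outer adm U w B <=
  cover_outer adm U w (A `|` B).
Proof.
move=> w0 sepAB; apply: le_ereal_inf_tmp => _ [c [cadm cAB] <-].
pose r (D : set 'rV[R]_n) k := if c k is Some i then
  (if `[< U i `&` D !=set0 >] then Some i else None) else None.
have rcov D : D `<=` A `|` B -> cover_of adm U D (r D).
  move=> DAB; split => [k i|x Dx].
    rewrite /r; case ck : (c k) => [j|//]; case: ifP => // _ [<-].
    exact: cadm ck.
  have [k _ xk] := cAB _ (DAB _ Dx); exists k => //; rewrite /r.
  case: (c k) xk => //= i Ux; rewrite asboolT//; by exists x.
have ow0 o : 0 <= oapp w 0 o by case: o.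
apply: (@le_trans _ _ (\sum_(k <oo) oapp w 0 (r A k) +
    \sum_(k <oo) oapp w 0 (r B k))).
  by apply: leeD; apply: ereal_inf_lbound;
    [exists (r A)|exists (r B)] => //; apply: rcov; [left|right].
rewrite -nneseriesD//; apply: lee_nneseries => [k _ _|k _].
  by rewrite adde_ge0.
rewrite /r; case ck : (c k) => [i|]; last by rewrite /= adde0.
case: asboolP => iA; case: asboolP => iB; rewrite /= ?adde0 ?add0e//.
by exfalso; apply: (sepAB i) => //; exact: cadm ck.
Qed.

Lemma hausdorff_weight_ge0 k (A : set 'rV[R]_n) : 0 <= hausdorff_weight k A.
Proof.
apply: mule_ge0; first exact: measure_ge0.
by apply/expe_ge0/mule_ge0; [rewrite lee_fin invr_ge0|exact: ediam_ge0].
Qed.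

Lemma hausdorff_pre_anti k (A : set 'rV[R]_n) (d d' : R) : (d <= d')%R ->
  hausdorff_pre k d' A <= hausdorff_pre k d A.
Proof.
move=> dd'; apply: ereal_inf_le_tmp => _ [c [cadm cA] <-]; exists c => //.
split => // j i ji /=; apply: le_trans (cadm _ _ ji) _.
by rewrite lee_fin.
Qed.

(** At scales finer than the distance between A and B, no covering set meets
    both.  The coarser pre-measures are smaller, so two independent scales may
    be used for A and B, and the two suprema are taken one after the other. *)
Lemma hausdorff_outer_metric k : metric_outer (@hausdorff_outer R n k).
Proof.
move=> A B e e0 AB; set H := hausdorff_outer k (A `|` B).
have sum_le d d' : (0 < d)%R -> (0 < d')%R ->
    hausdorff_pre k d A + hausdorff_pre k d' B <= H.
  move=> d0 d'0; pose m := (Num.min (e / 2) (Num.min d d'))%R.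
  have m0 : (0 < m)%R by rewrite !lt_min d0 d'0 divr_gt0.
  apply: (@le_trans _ _ (hausdorff_pre k m (A `|` B))); last first.
    by apply: ereal_sup_ubound; exists m.
  apply: (@le_trans _ _ (hausdorff_pre k m A + hausdorff_pre k m B)).
    by apply: leeD; apply: hausdorff_pre_anti; rewrite /m !ge_min lexx !orbT.
  apply: cover_outerU_separated; first exact: hausdorff_weight_ge0.
  move=> D /= Dm [a [Da Aa]] [b [Db Bb]].
  have : (enorm (a - b))%:E <= m%:E.
    apply: le_trans Dm; apply: ereal_sup_ubound; right; exists a => //.
    by exists b.
  rewrite lee_fin => abm; have := AB _ _ Aa Bb.
  apply/negP; rewrite -ltNge; apply: le_lt_trans abm _.
  by rewrite /m gt_min ltr_pdivrMr// ltr_pMr// ltr1n.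
(* The suprema over the two scales are taken one at a time, the other summand
   being moved to the right-hand side; so all of them have to be finite. *)
have [->|Hfin] := eqVneq H +oo; first exact: leey.
have pre0 d D : 0 <= hausdorff_pre k d (D : set 'rV[R]_n).
  by apply: cover_outer_ge0; exact: hausdorff_weight_ge0.
have {}Hfin : H \is a fin_num.
  by rewrite ge0_fin_numE ?outer_measure_ge0// ltey.
have fin d d' : (0 < d)%R -> (0 < d')%R ->
    (hausdorff_pre k d A \is a fin_num) /\ (hausdorff_pre k d' B \is a fin_num).
  move=> d0 d'0; rewrite !ge0_fin_numE//; have := sum_le _ _ d0 d'0 => sH.
  have Hoo : H < +oo by rewrite -ge0_fin_numE ?outer_measure_ge0.
  by split; apply: le_lt_trans Hoo; apply: le_trans sH; rewrite ?leeDl ?leeDr.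
have le1 d : (0 < d)%R -> hausdorff_outer k A + hausdorff_pre k d B <= H.
  move=> d0; rewrite -leeBrDr; last by have [] := fin _ _ d0 d0.
  apply: ge_ereal_sup => _ [d' d'0 <-].
  rewrite leeBrDr; [exact: sum_le|by have [] := fin _ _ d0 d0].
have Afin : hausdorff_outer k A \is a fin_num.
  rewrite ge0_fin_numE ?outer_measure_ge0//.
  apply: (@le_lt_trans _ _ H); last by rewrite -ge0_fin_numE ?outer_measure_ge0.
  by apply: le_trans (le1 _ ltr01); rewrite leeDl.
rewrite addeC -leeBrDr//; apply: ge_ereal_sup => _ [d d0 <-].
by rewrite leeBrDr// addeC; exact: le1.
Qed.

End metric_outer_measure.

(** * Measurability of half-spaces, balls and cubes *)

Section halfspaces.
Context {R : realType} {n : nat}.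

Lemma le_clip_length (a b c : R) :
  Num.max 0 (Num.min b c - a) + Num.max 0 (b - Num.max a c) <=
  Num.max 0 (b - a).
Proof.
by rewrite /Num.max /Num.min; do ! case: ifP; lra.
Qed.

Definition set_coord (x : 'rV[R]_n) (i : 'I_n) (c : R) : 'rV[R]_n :=
  \row_j (if j == i then c else x 0 j).

Lemma box_volume_clip i (c : R) (ab : 'rV[R]_n * 'rV[R]_n) :
  (box_volume (ab.1, set_coord ab.2 i (Num.min (ab.2 0 i) c)%R) +
   box_volume (set_coord ab.1 i (Num.max (ab.1 0 i) c)%R, ab.2) <=
   box_volume ab)%E.
Proof.
rewrite -EFinD lee_fin.
pose p := \prod_(j < n | j != i) Num.max 0 (ab.2 0 j - ab.1 0 j).
have -> : \prod_(j < n) Num.max 0 (ab.2 0 j - ab.1 0 j) =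
    Num.max 0 (ab.2 0 i - ab.1 0 i) * p by rewrite (bigD1 i).
have -> : \prod_(j < n) Num.max 0
    (set_coord ab.2 i (Num.min (ab.2 0 i) c) 0 j - ab.1 0 j) =
    Num.max 0 (Num.min (ab.2 0 i) c - ab.1 0 i) * p.
  rewrite (bigD1 i)//= [set_coord _ _ _ _ _]mxE eqxx; congr (_ * _).
  by apply: eq_bigr => j /negPf ji; rewrite mxE ji.
have -> : \prod_(j < n) Num.max 0
    (ab.2 0 j - set_coord ab.1 i (Num.max (ab.1 0 i) c) 0 j) =
    Num.max 0 (ab.2 0 i - Num.max (ab.1 0 i) c) * p.
  rewrite (bigD1 i)//= [set_coord _ _ _ _ _]mxE eqxx; congr (_ * _).
  by apply: eq_bigr => j /negPf ji; rewrite mxE ji.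
rewrite -mulrDl ler_wpM2r ?le_clip_length//.
by apply: prodr_ge0 => j _; rewrite le_max lexx.
Qed.

Lemma box_volume_ge0 (ab : 'rV[R]_n * 'rV[R]_n) : (0 <= box_volume ab)%E.
Proof. by rewrite lee_fin prodr_ge0// => i _; rewrite le_max lexx. Qed.

(** A hyperplane cuts a half-open box into two half-open boxes whose volumes
    add up to at most the volume of the box; cutting every box of a cover of A
    yields covers of the two parts of A. *)
Lemma halfspace_leb_caratheodory i (c : R) :
  (@leb_outer R n).-caratheodory [set x | x 0 i <= c].
Proof.
apply: le_caratheodory_measurable => A.
apply: le_ereal_inf_tmp => _ [C [_ CA] <-].
pose lo (ab : 'rV[R]_n * 'rV[R]_n) :=
  (ab.1, set_coord ab.2 i (Num.min (ab.2 0 i) c)).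
pose hi (ab : 'rV[R]_n * 'rV[R]_n) :=
  (set_coord ab.1 i (Num.max (ab.1 0 i) c), ab.2).
have ow0 o : (0 <= oapp (@box_volume R n) 0 o)%E.
  by case: o => //= ab; exact: box_volume_ge0.
apply: (@le_trans _ _
  (\sum_(k <oo) oapp (@box_volume R n) 0 (omap lo (C k)) +
   \sum_(k <oo) oapp (@box_volume R n) 0 (omap hi (C k)))%E); last first.
  rewrite -nneseriesD//; apply: lee_nneseries => [k _ _|k _].
    by rewrite adde_ge0.
  by case: (C k) => [ab|]/=; [exact: box_volume_clip|rewrite adde0].
apply: leeD; apply: ereal_inf_lbound.
  exists (fun k => omap lo (C k)) => //; split => // x [Ax /= xc].
  have [k _ xk] := CA _ Ax; exists k => //.
  case: (C k) xk => //= ab xab j; have /andP[xa xb] := xab j.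
  rewrite xa mxE; case: eqP => [ji|//]; rewrite le_min -ji xb.
  by rewrite ji.
exists (fun k => omap hi (C k)) => //; split => // x [Ax /= /negP].
rewrite -ltNge => xc.
have [k _ xk] := CA _ Ax; exists k => //.
case: (C k) xk => //= ab xab j; have /andP[xa xb] := xab j.
rewrite xb andbT mxE; case: eqP => [ji|//]; rewrite gt_max -ji xa.
by rewrite ji.
Qed.

(** The only property of the Lebesgue and Hausdorff outer measures that is
    used to obtain measurable functions: it makes the coordinates measurable. *)
Definition measures_halfspaces (mu : set 'rV[R]_n -> \bar R) :=
  forall i (c : R), mu.-caratheodory [set x | x 0 i <= c].

Lemma hausdorff_measures_halfspaces k :
  measures_halfspaces (@hausdorff_outer R n k).
Proof.
move=> i c; apply: metric_outer_caratheodory.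
  exact: hausdorff_outer_metric.
exact: halfspace_enorm_closed.
Qed.

Lemma measurable_coord (mu : {outer_measure set 'rV[R]_n -> \bar R}) i :
  measures_halfspaces mu ->
  measurable_fun setT ((fun x => x 0 i) : caratheodory_type mu -> R).
Proof.
move=> muh; apply: (measurability _ (RGenOInfty.measurableE R)).
move=> _ [_ [c ->] <-]; rewrite setTI.
have -> : (fun x : caratheodory_type mu => (x : 'rV[R]_n) 0 i) @^-1` `]c, +oo[ =
    ~` [set x | (x : 'rV[R]_n) 0 i <= c].
  by apply/seteqP; split => x /=; rewrite in_itv/= andbT ltNge => /negP.
apply: measurableC; exact: muh.
Qed.

(** The relation underlying the exchange of integrals.  It is a sublevel set
    of the sum of the squares of the differences of coordinates. *)
Lemma measurable_near (mu nu : {outer_measure set 'rV[R]_n -> \bar R}) (r : R) :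
  measures_halfspaces mu -> measures_halfspaces nu -> 0 < r ->
  measurable [set z : caratheodory_type mu * caratheodory_type nu |
    enorm ((z.1 : 'rV[R]_n) - z.2) < r].
Proof.
move=> muh nuh r0.
pose q (z : caratheodory_type mu * caratheodory_type nu) : R :=
  \sum_(i < n) ((z.1 : 'rV[R]_n) 0 i - (z.2 : 'rV[R]_n) 0 i) ^+ 2.
have mq : measurable_fun setT q.
  apply: measurable_sum => i; apply: measurable_funX; apply: measurable_funB.
    by apply: (measurableT_comp (measurable_coord i muh)).
  by apply: (measurableT_comp (measurable_coord i nuh)).
have qE z : (enorm ((z.1 : 'rV[R]_n) - z.2) < r) = (q z < r ^+ 2).
  rewrite -[LHS](ltr_pXn2r (n := 2))// ?nnegrE ?enorm_ge0 ?ltW// sqr_enorm.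
  by congr (_ < _); apply: eq_bigr => i _; rewrite !mxE.
have -> : [set z : caratheodory_type mu * caratheodory_type nu |
    enorm ((z.1 : 'rV[R]_n) - z.2) < r] = q @^-1` `]-oo, r ^+ 2[.
  by apply/seteqP; split => z /=; rewrite in_itv/= qE.
rewrite -[X in measurable X]setTI; exact: mq.
Qed.

Lemma measurable_eball (mu : {outer_measure set 'rV[R]_n -> \bar R}) x (r : R) :
  measures_halfspaces mu -> 0 < r ->
  measurable (eball x r : set (caratheodory_type mu)).
Proof.
move=> muh r0; have := measurable_near muh muh r0.
move=> /(measurable_ysection (x : caratheodory_type mu)); congr measurable.
by apply/seteqP; split => y; rewrite /ysection/= inE.
Qed.

(** Compact sets of finite Lebesgue measure that exhaust the space: they show
    that the two measures involved are sigma-finite. *)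
Definition cube (k : nat) : set 'rV[R]_n :=
  [set x | forall i, `|x 0 i| <= k%:R].

Lemma bigcup_cube : \bigcup_k cube k = setT.
Proof.
apply/seteqP; split => // x _; exists (Num.truncn (enorm x)).+1 => // i.
apply: le_trans (coord_le_enorm _ _) _; apply/ltW; exact: truncnS_gt.
Qed.

Lemma measurable_cube (mu : {outer_measure set 'rV[R]_n -> \bar R}) k :
  measures_halfspaces mu -> measurable (cube k : set (caratheodory_type mu)).
Proof.
move=> muh.
have -> : cube k = \bigcap_(i : 'I_n)
   ((fun x : caratheodory_type mu => (x : 'rV[R]_n) 0 i) @^-1` `[- k%:R, k%:R]).
  apply/seteqP; split => x /= xk.
    by move=> i _; rewrite /= in_itv/= -ler_norml.
  by move=> i; have := xk i Logic.I; rewrite /= in_itv/= -ler_norml.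
apply: fin_bigcap_measurable => // i _; rewrite -[X in measurable X]setTI.
apply: (measurable_coord i muh) => //; exact: measurable_itv.
Qed.

Lemma compact_cube k : compact (cube k).
Proof.
have -> : cube k =
    [set v : 'rV[R]_n | forall i, `[- k%:R, k%:R]%classic (v ord0 i)].
  apply/seteqP; split => x /= xk i; have := xk i;
    by rewrite /= in_itv/= -ler_norml.
apply: (@rV_compact R n (fun=> `[- k%:R, k%:R]%classic)) => i.
exact: segment_compact.
Qed.

Lemma leb_cube_fin k : (leb (cube k) < +oo)%E.
Proof.
(* The box is open on the left, so its left end has to move below - k. *)
pose ab := (const_mx (- k.+1%:R), const_mx k%:R) : 'rV[R]_n * 'rV[R]_n.
apply: (@le_lt_trans _ _ (box_volume ab)); last exact: ltry.
apply: ereal_inf_lbound; exists (fun j => if j == 0%N then Some ab else None).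
  split => // x xk; exists 0%N => //= i; rewrite !mxE.
  have := xk i; rewrite ler_norml => /andP[x1 ->]; rewrite andbT.
  by apply: lt_le_trans x1; rewrite ltrN2 ltr_nat.
rewrite nneseries_recl//=.
  by rewrite eseries0 ?adde0// => i; case: i.
by move=> i _; case: ifP => //= _; exact: box_volume_ge0.
Qed.

Lemma leb_sigma_finite :
  sigma_finite [set: caratheodory_type (@leb_outer R n)] leb.
Proof.
exists cube; first by rewrite bigcup_cube.
move=> k; split; last exact: leb_cube_fin.
by apply: measurable_cube; exact: halfspace_leb_caratheodory.
Qed.

End halfspaces.

(** * Integrals of non-negative functions *)

Lemma ge0_integral_sum_pair d (T : measurableType d) (R : realType)
    (mu : {measure set T -> \bar R}) (D : set T) n (f g : 'I_n -> T -> R) :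
  measurable D ->
  (forall i, measurable_fun D (f i)) -> (forall i, measurable_fun D (g i)) ->
  (forall i y, 0 <= f i y) -> (forall i y, 0 <= g i y) ->
  (\int[mu]_(y in D) (\sum_(i < n) (f i y + g i y))%:E =
   \sum_(i < n) (\int[mu]_(y in D) (f i y)%:E +
                 \int[mu]_(y in D) (g i y)%:E))%E.
Proof.
move=> mD mf mg f0 g0.
transitivity (\int[mu]_(y in D) (\sum_(i < n) ((f i y)%:E + (g i y)%:E)))%E.
  by apply: eq_integral => y _; rewrite sumEFin.
rewrite ge0_integral_sum//; last 2 first.
- by move=> i; apply: emeasurable_funD; exact/measurable_EFinP.
- by move=> i y _; rewrite adde_ge0// lee_fin.
by apply: eq_bigr => i _; rewrite ge0_integralD//;
  [move=> y _; rewrite lee_fin|exact/measurable_EFinP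
  |move=> y _; rewrite lee_fin|exact/measurable_EFinP].
Qed.

Section integration.
Import HBNNSimple.
Local Open Scope ereal_scope.

(** The integral of a non-negative function is a supremum over the simple
    functions below it, hence monotone.  The functions are arbitrary
    because the lemma serves to compare majorants, as well as integrals over
    neighbourhoods. *)
Lemma le_integral_nonneg d (T : measurableType d) (R : realType)
    (mu : {measure set T -> \bar R}) (D : set T) (f g : T -> \bar R) :
  (forall x, D x -> 0 <= f x) -> (forall x, D x -> f x <= g x) ->
  \int[mu]_(x in D) f x <= \int[mu]_(x in D) g x.
Proof.
move=> f0 fg; rewrite !ge0_integralE//; last first.
  by move=> x Dx; apply: le_trans (fg _ Dx); exact: f0.
apply: ereal_sup_le => _ [s sf <-]; exists s => // x.
apply: le_trans (sf x) _; rewrite /patch; case: ifP => //.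
by rewrite inE => /fg.
Qed.

Lemma sintegral_mrestr d (T : measurableType d) (R : realType)
    (mu : {measure set T -> \bar R}) (D : set T) (mD : measurable D)
    (s : {nnsfun T >-> R}) :
  sintegral (mrestr mu mD) s = \int[mu]_(x in D) (s x)%:E.
Proof.
rewrite integral_nnsfun// !sintegralET; apply: eq_fsbigr => r _.
have [->|r0] := eqVneq r 0%R; first by rewrite !mul0e.
congr (_ * mu _); apply/seteqP; split => x /=; rewrite /patch.
  by move=> [sx Dx]; rewrite mem_set.
by case: ifPn => [|_ /esym/eqP]; [rewrite inE|rewrite (negPf r0)].
Qed.

(** Measuring with the restriction of mu to D is integrating over D; it is
    the restriction that is sigma-finite, while the integral to bound is an
    integral over D. *)
Lemma integral_mrestr_le d (T : measurableType d) (R : realType)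
    (mu : {measure set T -> \bar R}) (D : set T) (mD : measurable D)
    (f g : T -> \bar R) :
  (forall x, 0 <= f x) -> (forall x, D x -> f x <= g x) ->
  \int[mrestr mu mD]_x f x <= \int[mu]_(x in D) g x.
Proof.
move=> f0 fg; rewrite ge0_integralTE//; apply: ge_ereal_sup => _ [s sf <-].
rewrite sintegral_mrestr; apply: le_integral_nonneg => x Dx.
  by rewrite lee_fin; exact: fun_ge0.
by apply: le_trans (fg _ Dx); exact: sf.
Qed.

End integration.

(** * Exchanging integrals along a relation *)

(** Sigma-finiteness occurs below as a hypothesis on a given measure, whereas
    Tonelli's theorem expects it in the structure of the measure; this copy of
    the measure carries it there. *)
Definition as_sigma_finite d (T : measurableType d) (R : realType)
    (m : {measure set T -> \bar R}) (fin : sigma_finite setT m) :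
  set T -> \bar R := m.

Section as_sigma_finite.
Context d (T : measurableType d) (R : realType).
Variables (m : {measure set T -> \bar R}) (fin : sigma_finite setT m).

HB.instance Definition _ := Measure.copy (as_sigma_finite fin) m.
HB.instance Definition _ :=
  Measure_isSigmaFinite.Build _ _ _ (as_sigma_finite fin) fin.

End as_sigma_finite.

Section tonelli_section.
Local Open Scope ereal_scope.
Context d1 d2 (T1 : measurableType d1) (T2 : measurableType d2) (R : realType).
Variables (m1 : {measure set T1 -> \bar R}) (m2 : {measure set T2 -> \bar R}).
Hypotheses (fin1 : sigma_finite setT m1) (fin2 : sigma_finite setT m2).
Variables (f : T2 -> R) (N : set (T1 * T2)).
Hypotheses (f0 : forall y, (0 <= f y)%R) (mf : measurable_fun setT f).
Hypothesis mN : measurable N.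

Let phi (z : T1 * T2) : \bar R := (f z.2 * \1_N z)%:E.

Let phi0 z : 0 <= phi z.
Proof. by rewrite lee_fin mulr_ge0. Qed.

Let mphi : measurable_fun setT phi.
Proof.
apply/measurable_EFinP; apply: measurable_funM; first exact: measurableT_comp.
exact: measurable_indic.
Qed.

Let fubini_FE x : \int[m2]_(y in xsection N x) (f y)%:E = fubini_F m2 phi x.
Proof.
rewrite /fubini_F integral_mkcond; apply: eq_integral => y _.
rewrite /phi /patch indicE mem_xsection.
by case: ifP => _; rewrite ?mulr1 ?mulr0.
Qed.

Let fubini_GE y : (f y)%:E * m1 (ysection N y) = fubini_G m1 phi y.
Proof.
have mNy : measurable (ysection N y) by exact: measurable_ysection.
rewrite /fubini_G -[ysection N y]setIT -(integral_indic _ measurableT)//.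
rewrite -ge0_integralZl ?lee_fin//.
- by apply: eq_integral => x _; rewrite /phi EFinM !indicE mem_ysection.
- by apply/measurable_EFinP; exact: measurable_indic.
Qed.

Lemma measurable_integral_xsection :
  measurable_fun setT (fun x => \int[m2]_(y in xsection N x) (f y)%:E).
Proof.
rewrite (funext fubini_FE).
exact: (measurable_fun_fubini_tonelli_F (m2 := as_sigma_finite fin2)).
Qed.

Lemma measurable_ysection_weight :
  measurable_fun setT (fun y => (f y)%:E * m1 (ysection N y)).
Proof.
rewrite (funext fubini_GE).
exact: (measurable_fun_fubini_tonelli_G (m1 := as_sigma_finite fin1)).
Qed.

(** Tonelli's theorem for (x, y) |-> f y 1_N(x, y). *)
Lemma integral_xsection_exchange :
  \int[m1]_x \int[m2]_(y in xsection N x) (f y)%:E =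
  \int[m2]_y ((f y)%:E * m1 (ysection N y)).
Proof.
rewrite (funext fubini_FE) (funext fubini_GE).
exact: (@fubini_tonelli _ _ _ _ _
  (as_sigma_finite fin1) (as_sigma_finite fin2)).
Qed.

End tonelli_section.

Section integral_section_bound.
Local Open Scope ereal_scope.
Context d1 d2 (T1 : measurableType d1) (T2 : measurableType d2) (R : realType).

(** Write I x for the integral of f over the x-section of N.  Integrating
    a I <= h over S and exchanging the integrals gives
    a \int f y m (ysection N y `&` S) <= \int_S h, and on W the weight
    m (ysection N y `&` S) is at least g. *)
Lemma integral_section_le (m : {measure set T1 -> \bar R})
    (m2 : {measure set T2 -> \bar R}) (S : set T1) (mS : measurable S)
    (N : set (T1 * T2)) (W : set T2) (f : T2 -> R) (h : T1 -> \bar R)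
    (a g : R) :
  sigma_finite setT (mrestr m mS) -> sigma_finite setT m2 -> measurable N ->
  measurable_fun setT f -> (forall y, 0 <= f y)%R -> (0 < a)%R -> (0 < g)%R ->
  (forall y, W y -> g%:E <= m (ysection N y `&` S)) ->
  (forall x, S x -> a%:E * \int[m2]_(y in xsection N x) (f y)%:E <= h x) ->
  \int[m2]_(y in W) (f y)%:E <= ((a * g)^-1)%:E * \int[m]_(x in S) h x.
Proof.
move=> fin1 fin2 mN mf f0 a0 g0 dens fh.
pose m1 := mrestr m mS.
pose I x := \int[m2]_(y in xsection N x) (f y)%:E.
have I0 x : 0 <= I x by apply: integral_ge0 => y _; rewrite lee_fin.
have upper : a%:E * \int[m1]_x I x <= \int[m]_(x in S) h x.
  rewrite -ge0_integralZl//; last 2 first.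
    exact: measurable_integral_xsection.
    by rewrite lee_fin ltW.
  by apply: integral_mrestr_le => // x; rewrite mule_ge0// lee_fin ltW.
have lower : \int[m2]_(y in W) (f y)%:E <= (g^-1)%:E * \int[m1]_x I x.
  rewrite (integral_xsection_exchange fin1 fin2)//.
  rewrite -ge0_integralZl//; last 3 first.
    exact: measurable_ysection_weight.
    by move=> y _; rewrite mule_ge0 ?lee_fin.
    by rewrite lee_fin invr_ge0 ltW.
  rewrite integral_mkcond; apply: le_integral_nonneg => y _.
    by rewrite /patch; case: ifP => //; rewrite lee_fin.
  rewrite /patch; case: ifPn => [|_]; last first.
    by rewrite mule_ge0// ?lee_fin ?invr_ge0 ?(ltW g0)// mule_ge0 ?lee_fin.
  rewrite inE => Wy; rewrite muleCA -[leLHS]mule1 lee_wpmul2l ?lee_fin//.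
  by rewrite lee_pdivlMl// mule1; exact: dens.
apply: (le_trans lower); rewrite invfM mulrC EFinM -muleA.
rewrite lee_wpmul2l ?lee_fin ?invr_ge0 ?(ltW g0)//.
by rewrite lee_pdivlMl.
Qed.

End integral_section_bound.

(** * Integrals over neighbourhoods of a set of positive lower density *)

Section enbhd_integral.
Local Open Scope ereal_scope.
Context {R : realType} {n : nat}.

(** Here the relation is being at distance less than 2 e.  A point y of the
    e-neighbourhood of S is at distance less than e from some x in S, and the
    ball of radius 2 e around y then contains the ball of radius e around x,
    in which S has measure at least g. *)
Lemma integral_enbhd_le k (S : set 'rV[R]_n)
    (mS : measurable (S : set (caratheodory_type (@hausdorff_outer R n k))))
    (f : 'rV[R]_n -> R) (h : 'rV[R]_n -> \bar R) (a g e : R) :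
  sigma_finite setT (mrestr (@hausdorff R n k) mS) ->
  measurable_fun setT (f : caratheodory_type (@leb_outer R n) -> R) ->
  (forall y, 0 <= f y)%R ->
  (0 < a)%R -> (0 < g)%R -> (0 < e)%R ->
  (forall x, S x -> g%:E <= hausdorff k (S `&` eball x e)) ->
  (forall x, S x -> a%:E * \int[leb]_(y in eball x (2 * e)) (f y)%:E <= h x) ->
  \int[leb]_(y in enbhd S e) (f y)%:E <=
    ((a * g)^-1)%:E * \int[hausdorff k]_(x in S) h x.
Proof.
move=> Sfin mf f0 a0 g0 e0 dens fh.
pose N : set (caratheodory_type (@hausdorff_outer R n k) *
   caratheodory_type (@leb_outer R n)) :=
  [set z | (enorm ((z.1 : 'rV[R]_n) - z.2) < 2 * e)%R].
have mN : measurable N.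
  apply: measurable_near; rewrite ?mulr_gt0//.
    exact: hausdorff_measures_halfspaces.
  exact: halfspace_leb_caratheodory.
apply: (integral_section_le Sfin leb_sigma_finite mN) => //.
  move=> y [x Sx yx]; apply: le_trans (dens _ Sx) _.
  apply: le_outer_measure => z [Sz zx]; split => //.
  rewrite /ysection/= inE /N/=; apply: le_lt_trans (enorm_triangle z x y) _.
  by rewrite mulr_natl mulr2n ltrD// enorm_distC.
move=> x Sx; have -> : xsection N x = eball x (2 * e).
  by apply/seteqP; split => y; rewrite /xsection/= inE /N/= enorm_distC.
exact: fh.
Qed.

Lemma sigma_finite_hausdorff_restr k (S : set 'rV[R]_n)
    (mS : measurable (S : set (caratheodory_type (@hausdorff_outer R n k)))) :
  (forall K : set 'rV[R]_n, compact K -> (hausdorff k (S `&` K) < +oo)%E) ->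
  sigma_finite setT (mrestr (@hausdorff R n k) mS).
Proof.
move=> Sfin; exists cube; first by rewrite bigcup_cube.
move=> j; split.
  by apply: measurable_cube; exact: hausdorff_measures_halfspaces.
by rewrite /mrestr setIC; apply: Sfin; exact: compact_cube.
Qed.

End enbhd_integral.

(** * Lower bounds for mollifications and majorants *)

Section mollification.
Context {R : realType} {n : nat}.
Local Notation lebT := (caratheodory_type (@leb_outer R n)).
Variable rho : 'rV[R]_n -> R.
Hypothesis hrho : standard_mollifier rho.

Lemma mollifier_continuous : continuous rho.
Proof. exact: (mollifier_smooth hrho 0). Qed.

Lemma mollifier_bounded : exists2 M, 0 <= M & forall x, rho x <= M.
Proof.
have /compact_bounded[M [_ rM]] : compact (rho @` supp rho).
  apply: continuous_compact; last exact: mollifier_compact hrho.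
  by apply: continuous_subspaceT; exact: mollifier_continuous.
exists (`|M| + 1) => [|x]; first by rewrite addr_ge0.
have [->|x0] := eqVneq (rho x) 0; first by rewrite addr_ge0.
apply: le_trans (ler_norm _) _; apply: (rM (`|M| + 1)).
  by apply: le_lt_trans (ler_norm _) _; rewrite ltrDl.
by exists x => //; exact: subset_closure.
Qed.

Lemma mollifier_core : exists c s : R, [/\ 0 < c, 0 < s &
  forall z, enorm z < s -> c <= rho z].
Proof.
have r0 := mollifier_gt0 hrho; pose c := rho 0 / 2.
have c0 : 0 < c by rewrite divr_gt0.
have : nbhs (0 : 'rV[R]_n) [set z | c <= rho z].
  have cr : c < rho 0 by rewrite ltr_pdivrMr// ltr_pMr// ltr1n.
  have rho_cvg : rho z @[z --> (0 : 'rV[R]_n)] --> rho 0.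
    exact: mollifier_continuous.
  by apply: (rho_cvg [set t | c <= t]); apply: filterS (lt_nbhsr cr) => t /ltW.
move=> /nbhs_eball[s s0 cs]; exists c, s; split => // z zs.
by apply: cs; rewrite subr0.
Qed.

(** The kernel is at least c delta^-n on the ball of radius s delta.  As the
    mollification is the fine part of an extended real integral, and fine sends
    +oo to 0, that integral has to be finite: rho is bounded. *)
Lemma mollify_ge (c s : R) delta (f : 'rV[R]_n -> R) k x :
  0 < c -> 0 < s -> (forall z, enorm z < s -> c <= rho z) ->
  0 < delta k -> (forall y, 0 <= f y) ->
  leb.-integrable setT (EFin \o (f : lebT -> R)) ->
  ((c * delta k ^- n)%:E * \int[leb]_(y in eball x (s * delta k)) (f y)%:E <=
   (mollify rho delta f k x)%:E)%E.
Proof.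
move=> c0 s0 cs d0 f0 fint; set d := delta k in d0 *.
have [M M0 rM] := mollifier_bounded.
have mf : measurable_fun setT (EFin \o (f : lebT -> R)).
  by case/integrableP : fint.
have dn0 : 0 <= d ^- n by rewrite invr_ge0 exprn_ge0 ?ltW.
pose J := (\int[leb]_y (f y * rescale rho d (x - y))%:E)%E.
have rho0 := mollifier_ge0 hrho.
have rs0 z : 0 <= rescale rho d z by rewrite mulr_ge0.
have fJ : J \is a fin_num.
  rewrite ge0_fin_numE; last first.
    by apply: integral_ge0 => y _; rewrite lee_fin mulr_ge0.
  apply: (@le_lt_trans _ _ (\int[leb]_y ((d ^- n * M)%:E * (f y)%:E))%E).
    apply: le_integral_nonneg => y _; first by rewrite lee_fin mulr_ge0.
    by rewrite -EFinM lee_fin mulrC ler_wpM2r// ler_wpM2l.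
  rewrite ge0_integralZl ?lee_fin ?mulr_ge0//; last first.
    by move=> y _; rewrite lee_fin.
  rewrite lte_mul_pinfty ?lee_fin ?mulr_ge0//.
  case/integrableP : fint => _; congr (_ < _)%E; apply: eq_integral => y _.
  by rewrite /= ger0_norm.
rewrite [leRHS](_ : _ = J); last by rewrite -[RHS]fineK.
have mball : measurable (eball x (s * d) : set lebT).
  apply: measurable_eball; rewrite ?mulr_gt0//.
  exact: halfspace_leb_caratheodory.
rewrite -ge0_integralZl ?lee_fin ?mulr_ge0 ?(ltW c0)//; last 2 first.
  by apply: measurable_funTS.
  by move=> y _; rewrite lee_fin.
rewrite integral_mkcond; apply: le_integral_nonneg => y _.
  by rewrite /patch; case: ifP => // _; rewrite -EFinM lee_fin !mulr_ge0// ltW.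
rewrite /patch; case: ifPn => [|_]; last by rewrite lee_fin mulr_ge0.
rewrite inE => xy; rewrite -EFinM lee_fin mulrC ler_wpM2l// mulrC ler_wpM2l//.
apply: cs; rewrite enormZ gtr0_norm ?invr_gt0// enorm_distC.
by rewrite ltr_pdivrMl// mulrC.
Qed.

(** The k-th mollification is the first one plus a telescoping sum of
    increments, and the majorant contains the absolute values of all these. *)
Lemma mollify_le_majorant delta (f : 'rV[R]_n -> R) k x : (1 <= k)%N ->
  (`|mollify rho delta f k x|%:E <= majorant_formula rho delta f x)%E.
Proof.
move=> k1; rewrite /majorant_formula.
apply: (@le_trans _ _ (`|mollify rho delta f 1 x|%:E +
   \sum_(1 <= j < k)
     `|mollify rho delta f j.+1 x - mollify rho delta f j x|%:E)%E).
  elim: k k1 => // -[|k] IH _; first by rewrite big_geq// adde0.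
  rewrite big_nat_recr//= addeA.
  apply: (@le_trans _ _ (`|mollify rho delta f k.+1 x|%:E +
     `|mollify rho delta f k.+2 x - mollify rho delta f k.+1 x|%:E)%E).
    by rewrite -EFinD lee_fin addrC -lerBlDr lerB_dist.
  by apply: leeD2r; exact: IH.
rewrite -[leLHS]adde0; apply: leeD; last by rewrite lee_fin.
by apply: leeD2l; apply: nneseries_lim_ge => j _ _; rewrite lee_fin.
Qed.

End mollification.

Section field_majorant.
Context {R : realType} {n : nat}.
Local Notation lebT := (caratheodory_type (@leb_outer R n)).

(** This scalar function dominates |F|, and its integrals over balls split
    into those of the parts, each of which is controlled by one summand of the
    majorant of F. *)
Definition total_parts (F : 'rV[R]_n -> 'rV[R]_n) (y : 'rV[R]_n) : R :=
  \sum_(i < n) ((component F i)^\+ y + (component F i)^\- y).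

Lemma total_parts_ge0 F y : 0 <= total_parts F y.
Proof.
by apply: sumr_ge0 => i _; rewrite addr_ge0 ?funrpos_ge0 ?funrneg_ge0.
Qed.

Lemma enorm_le_total_parts F y : enorm (F y) <= total_parts F y.
Proof.
apply: le_trans (enorm_le_sum _) _; apply: ler_sum => i _.
by rewrite -[leLHS]/((Num.Def.normr \o component F i) y) -funrposDneg.
Qed.

Lemma measurable_parts (F : 'rV[R]_n -> 'rV[R]_n) : L1_field F -> forall i,
  measurable_fun setT ((component F i)^\+ : lebT -> R) /\
  measurable_fun setT ((component F i)^\- : lebT -> R).
Proof.
move=> FL i.
have /measurable_EFinP mF : measurable_fun setT (EFin \o component F i :
  lebT -> \bar R) by case/integrableP : (FL i).
by split; [exact: measurable_funrpos|exact: measurable_funrneg].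
Qed.

Lemma measurable_total_parts (F : 'rV[R]_n -> 'rV[R]_n) : L1_field F ->
  measurable_fun setT (total_parts F : lebT -> R).
Proof.
move=> FL; apply: measurable_sum => i; apply: measurable_funD.
  by case: (measurable_parts FL i).
by case: (measurable_parts FL i).
Qed.

Lemma integral_total_parts (F : 'rV[R]_n -> 'rV[R]_n) (B : set lebT) :
  L1_field F -> measurable B ->
  (\int[leb]_(y in B) (total_parts F y)%:E =
   \sum_(i < n) (\int[leb]_(y in B) ((component F i)^\+ y)%:E +
                 \int[leb]_(y in B) ((component F i)^\- y)%:E))%E.
Proof.
move=> FL mB.
have mp i : measurable_fun B ((component F i)^\+ : lebT -> R).
  by apply: measurable_funTS; case: (measurable_parts FL i).
have mm i : measurable_fun B ((component F i)^\- : lebT -> R).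
  by apply: measurable_funTS; case: (measurable_parts FL i).
have p0 i := @funrpos_ge0 _ _ (component F i).
have m0 i := @funrneg_ge0 _ _ (component F i).
exact: (ge0_integral_sum_pair (@leb R n) mB mp mm p0 m0).
Qed.

Lemma ball_integral_le_majorant rho (hrho : standard_mollifier rho) (c s : R)
    F h :
  (0 < n)%N -> 0 < c -> 0 < s -> (forall z, enorm z < s -> c <= rho z) ->
  L1_field F -> precise_majorant rho F h ->
  exists delta : nat -> R, decreasing_to0 delta /\ forall k x, (1 <= k)%N ->
   ((c * delta k ^- n)%:E *
     \int[leb]_(y in eball x (s * delta k)) (total_parts F y)%:E <= h x)%E.
Proof.
move=> n0 c0 s0 cs FL [delta [hp [hm [Hp Hm hE]]]]; exists delta.
(* The conditions on delta come with the majorant of any one component. *)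
have dec : decreasing_to0 delta by case: (Hp (Ordinal n0)).
split=> // k x k1; have d0 : 0 < delta k by case: dec => /(_ _ k1).
have mball : measurable (eball x (s * delta k) : set lebT).
  apply: measurable_eball; last by rewrite mulr_gt0.
  exact: halfspace_leb_caratheodory.
rewrite hE integral_total_parts// ge0_sume_distrr; last first.
  by move=> i _; rewrite adde_ge0//; apply: integral_ge0 => y _;
    rewrite lee_fin ?funrpos_ge0 ?funrneg_ge0.
apply: lee_sum => i _; rewrite ge0_muleDr; last 2 first.
- by apply: integral_ge0 => y _; rewrite lee_fin funrpos_ge0.
- by apply: integral_ge0 => y _; rewrite lee_fin funrneg_ge0.
have bound f g : (forall y, 0 <= f y) ->
    leb.-integrable setT (EFin \o (f : lebT -> R)) ->
    precise_majorant_along rho delta f g ->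
    ((c * delta k ^- n)%:E *
      \int[leb]_(y in eball x (s * delta k)) (f y)%:E <= g x)%E.
  move=> f0 fL [_ _ ->].
  apply: le_trans (mollify_ge hrho x c0 s0 cs d0 f0 fL) _.
  by apply: le_trans (mollify_le_majorant _ _ _ _ k1); rewrite lee_fin ler_norm.
apply: leeD; apply: bound; [exact: funrpos_ge0| |exact: Hp
  |exact: funrneg_ge0| |exact: Hm].
  exact: integrable_funrpos.
exact: integrable_funrneg.
Qed.

End field_majorant.

(** * The main estimate *)

Lemma limf_einf_le (T : choiceType) (X : filteredType T) (R : realType)
    (f : X -> \bar R) (F : set (set X)) (K : \bar R) :
  (forall V, F V -> exists2 x, V x & (f x <= K)%E) -> (limf_einf f F <= K)%E.
Proof.
move=> FK; rewrite /limf_einf leeNl; apply: le_ereal_inf_tmp => _ [V FV <-].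
have [x Vx fxK] := FK _ FV.
apply: le_ereal_sup_tmp; exists (- f x)%E.
  by exists x.
by rewrite leeN2.
Qed.

Theorem theorem1p1 (R : realType) (n : nat) (hn : (2 <= n)%N)
    (rho : 'rV[R]_n -> R) (hrho : standard_mollifier rho)
    (E : set 'rV[R]_n) (hE : finite_perimeter E)
    (hdE : uniform_lower_density (frontier E)) :
  exists2 gamma : R, 0 < gamma &
    forall (F : 'rV[R]_n -> 'rV[R]_n) (h : 'rV[R]_n -> \bar R),
      L1_field F -> precise_majorant rho F h ->
      (limf_einf (fun eps : R => ((2 * eps)^-1)%:E *
          \int[leb]_(x in enbhd (frontier E) eps) (enorm (F x))%:E) 0^'+
        <= gamma%:E * \int[hausdorff n.-1]_(x in frontier E) h x)%E.
Proof.
have n0 : (0 < n)%N by exact: ltnW.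
have [c [s [c0 s0 cs]]] := mollifier_core hrho.
case: hdE => _ Sfin [g [R0 [g0 R00 dens]]].
exists ((2 * c * g)^-1 * (2 / s) ^+ n).
  by rewrite mulr_gt0 ?invr_gt0 ?exprn_gt0 ?mulr_gt0 ?invr_gt0.
move=> F h FL /(ball_integral_le_majorant hrho n0 c0 s0 cs FL).
move=> [delta [[d0 _ dcvg] ballh]].
set S := frontier E in Sfin dens *.
have mS : measurable (S : set (caratheodory_type (@hausdorff_outer R n n.-1))).
  apply: metric_outer_caratheodory; first exact: hausdorff_outer_metric.
  by apply: closed_enorm_closed; exact: frontier_closed.
(* The estimate holds at every scale eps = s / 2 * delta k.  The powers of eps
   cancel: 1 / (2 eps) from the quotient, eps ^ (n - 1) from the density of S
   and delta ^ n from the mollifier leave (2 / s) ^ n. *)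
have at_scale k : (1 <= k)%N -> s / 2 * delta k < R0 ->
    (((2 * (s / 2 * delta k))^-1)%:E *
      \int[leb]_(x in enbhd S (s / 2 * delta k)) (enorm (F x))%:E <=
    ((2 * c * g)^-1 * (2 / s) ^+ n)%:E * \int[hausdorff n.-1]_(x in S) h x)%E.
  move=> k1 eR0; have dk0 := d0 _ k1; set d := delta k in dk0 eR0 *.
  set e := s / 2 * d in eR0 *.
  have e0 : 0 < e by rewrite !mulr_gt0.
  have en0 : 0 < e ^+ n.-1 by rewrite exprn_gt0.
  have dn0 : 0 < d ^- n by rewrite invr_gt0 exprn_gt0.
  have int_le : (\int[leb]_(x in enbhd S e) (enorm (F x))%:E <=
      ((c * d ^- n * (g * e ^+ n.-1))^-1)%:E *
        \int[hausdorff n.-1]_(x in S) h x)%E.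
    apply: (@le_trans _ _ (\int[leb]_(x in enbhd S e) (total_parts F x)%:E)%E).
      apply: le_integral_nonneg => x _; first by rewrite lee_fin enorm_ge0.
      by rewrite lee_fin enorm_le_total_parts.
    apply: (integral_enbhd_le (sigma_finite_hausdorff_restr mS Sfin)) => //.
    - exact: measurable_total_parts.
    - exact: total_parts_ge0.
    - exact: mulr_gt0.
    - exact: mulr_gt0.
    - by move=> x Sx; apply: dens => //; rewrite e0.
    - move=> x _; have -> : 2 * e = s * d by rewrite /e; field.
      exact: ballh.
  have -> : (2 * c * g)^-1 * (2 / s) ^+ n =
      (2 * e)^-1 * (c * d ^- n * (g * e ^+ n.-1))^-1.
    rewrite -(prednK n0) /= !exprS /e !exprMn !exprVn.
    have [dN0 sN0 cN0 gN0] : [/\ d != 0, s != 0, c != 0 & g != 0].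
      by rewrite !gt_eqF.
    by field; rewrite !expf_neq0 ?pnatr_eq0// dN0 sN0 cN0 gN0.
  rewrite EFinM -muleA; apply: lee_wpmul2l => //.
  by rewrite lee_fin invr_ge0 ltW// mulr_gt0.
apply: limf_einf_le => V V0.
have ecvg : s / 2 * delta k @[k --> \oo] --> (0 : R).
  by rewrite -[X in _ --> X](mulr0 (s / 2)); apply: cvgM => //; exact: cvg_cst.
have [k [k1 eR0 Ve]] : exists k, [/\ (1 <= k)%N, s / 2 * delta k < R0 &
    V (s / 2 * delta k)].
  near \oo => k; exists k.
  have k1 : (1 <= k)%N by near: k; exists 1%N.
  split => //.
    by near: k; apply: (cvgr_lt _ ecvg).
  have : 0 < s / 2 * delta k by rewrite !mulr_gt0// d0.
  near: k; exact: (ecvg _ V0).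
by exists (s / 2 * delta k) => //; exact: at_scale.
Unshelve. all: by end_near.
Qed.
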